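(* Let $f,g:\mathbb{R}\to\mathbb{R}$ be two polynomial functions of the same degree $d\geq 1$. If $f$ and $g$ have no critical points, then $f$ and $g$ are Lipschitz equivalent.
   Context: Two nonzero polynomial functions $f,g:\mathbb{R}\to\mathbb{R}$ are Lipschitz equivalent, written $f\cong g$, if there exist a bi-Lipschitz homeomorphism $\phi:\mathbb{R}\to\mathbb{R}$ and a constant $c>0$ such that $g\circ\phi=cf$. Critical points are real points where the derivative vanishes. *)

(* Defs.v *)
From mathcomp Require Import all_boot all_order all_algebra.
From mathcomp Require Import all_classical all_reals all_analysis.
Set Implicit Arguments.
Unset Strict Implicit.
Unset Printing Implicit Defensive.
Import Order.TTheory GRing.Theory Num.Theory.
Import numFieldNormedType.Exports.
Local Open Scope classical_set_scope.
Local Open Scope ring_scope.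

(* Continuity is implied by the Lipschitz conditions; it is listed so that the
   definition reads as "homeomorphism, Lipschitz in both directions". *)
Definition bilipschitz_homeomorphism (R : realType) (phi : R -> R) : Prop :=
  exists psi : R -> R,
    [/\ cancel phi psi, cancel psi phi, continuous phi & continuous psi] /\
    (lipschitz phi /\ lipschitz psi).

(* The relation is meant for nonzero polynomial functions, but makes sense for
   arbitrary ones. *)
Definition lipschitz_equivalent (R : realType) (f g : R -> R) : Prop :=
  exists (phi : R -> R) (c : R),
    [/\ bilipschitz_homeomorphism phi, 0 < c & forall x, g (phi x) = c * f x].

(* [derive1] is total, with an unspecified value where [f] is not derivable, so
   derivability is required explicitly. *)
Definition critical_point (R : realType) (f : R -> R) (x : R) : Prop :=
  derivable f x 1 /\ derive1 f x = 0.

(* Main.v *)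
Require Import Defs.
From mathcomp Require Import all_boot all_order all_algebra.
From mathcomp Require Import all_classical all_reals all_analysis.
From mathcomp Require polyorder.
Import Order.TTheory GRing.Theory Num.Theory.
Import numFieldNormedType.Exports.
Local Open Scope ring_scope.
Set Implicit Arguments.
Unset Strict Implicit.
Unset Printing Implicit Defensive.

(** The equivalence is the map that matches equal values, with constant 1: since
    a derivative without real roots keeps a constant sign and is bounded away
    from 0, [f] and [g] are bijections of the line, and the composite [phi] of
    [f] with the inverse of [g] satisfies [g (phi x) = f x]. By symmetry it is
    enough to bound its derivative, which at [x] is [f^`().[x] / g^`().[u]] for
    [u = phi x].

    All growth estimates use the weight [max 1 |x|]. A polynomial of degree [n]
    is at most a constant times the [n]-th power of the weight, and at least a
    positive constant times that power if it has no real root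
    ([horner_le_weight], [weight_le_horner]). Hence the derivative of [phi] is
    at most a constant times the [(d - 1)]-th power of [weight x / weight u]. This
    ratio is bounded because [f x = g u] and both sides grow with the same
    exponent [d] ([weight_le_of_eq_horner]); to apply the lower bound to a
    polynomial that has a real root, it is replaced by [f ^+ 2 + 1], which has
    none. *)

(** * Growth of real polynomials *)

Definition weight (R : realType) (x : R) : R := Num.max 1 `|x|.

(** The polynomial [X^n p(1/X)], which describes [p] near infinity. *)
Definition reciprocal (R : realType) (n : nat) (p : {poly R}) : {poly R} :=
  \poly_(i < n.+1) p`_(n - i).

Lemma weight_ge1 (R : realType) (x : R) : 1 <= weight x.
Proof. by rewrite le_max lexx. Qed.

Lemma weight_gt0 (R : realType) (x : R) : 0 < weight x.
Proof. exact: lt_le_trans ltr01 (weight_ge1 x). Qed.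

Lemma weight_ge0 (R : realType) (x : R) : 0 <= weight x.
Proof. exact/ltW/weight_gt0. Qed.

Lemma horner_reciprocal (R : realType) (n : nat) (p : {poly R}) (x : R) :
  (size p <= n.+1)%N -> x != 0 -> p.[x] = x ^+ n * (reciprocal n p).[x^-1].
Proof.
move=> sp x0; rewrite (horner_coef_wide _ sp) horner_poly mulr_sumr.
rewrite (reindex_inj rev_ord_inj) /=; apply: eq_bigr => i _.
rewrite subSS mulrCA; congr (_ * _).
have le_in : (i <= n)%N by rewrite -ltnS.
by rewrite exprVn expfB_cond // (negbTE x0) add0n.
Qed.

Lemma horner_reciprocal0 (R : realType) (n : nat) (p : {poly R}) :
  (reciprocal n p).[0] = p`_n.
Proof. by rewrite horner_coef0 coef_poly subn0. Qed.

Lemma continuous_norm_horner (R : realType) (p : {poly R}) :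
  continuous (fun x => `|p.[x]|).
Proof.
by move=> x; apply: continuous_comp; [exact: continuous_horner
                                     |exact: norm_continuous].
Qed.

Lemma horner_bounded_on_unit (R : realType) (p : {poly R}) :
  exists2 C, 0 < C & forall x, `|x| <= 1 -> `|p.[x]| <= C.
Proof.
have N11 : -1 <= 1 :> R := le_trans (lerN10 R) ler01.
have [|c _ max_c] := @EVT_max R (fun x => `|p.[x]|) (- 1) 1 N11.
  exact/continuous_subspaceT/continuous_norm_horner.
exists (`|p.[c]| + 1) => [|x]; first by rewrite ltr_wpDl.
rewrite ler_norml => x1; apply: (le_trans (max_c x _)); last by rewrite lerDl.
by rewrite in_itv.
Qed.

Lemma horner_away_on_unit (R : realType) (p : {poly R}) :
  (forall x, ~~ root p x) ->
  exists2 a, 0 < a & forall x, `|x| <= 1 -> a <= `|p.[x]|.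
Proof.
move=> noroot.
have N11 : -1 <= 1 :> R := le_trans (lerN10 R) ler01.
have [|c _ min_c] := @EVT_min R (fun x => `|p.[x]|) (- 1) 1 N11.
  exact/continuous_subspaceT/continuous_norm_horner.
exists `|p.[c]| => [|x]; first by rewrite normr_gt0; exact: noroot.
by rewrite ler_norml => x1; apply: min_c; rewrite in_itv.
Qed.

(** On [-1, 1] this is compactness; elsewhere it is compactness again, for the
    reciprocal polynomial at [x^-1]. *)
Lemma horner_le_weight (R : realType) (n : nat) (p : {poly R}) :
  (size p <= n.+1)%N ->
  exists2 C, 0 < C & forall x, `|p.[x]| <= C * weight x ^+ n.
Proof.
move=> sp; have [C C0 boundp] := horner_bounded_on_unit p.
have [D D0 boundq] := horner_bounded_on_unit (reciprocal n p).
exists (Num.max C D) => [|x]; first by rewrite lt_max C0.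
rewrite /weight; have [x1|x1] := leP `|x| 1.
  by rewrite expr1n mulr1 le_max boundp.
have x0 : x != 0 by rewrite -normr_gt0 (lt_trans ltr01).
rewrite (horner_reciprocal sp x0) normrM normrX mulrC.
rewrite ler_wpM2r ?exprn_ge0 // le_max boundq ?orbT //.
by rewrite normfV invf_le1 ?normr_gt0 // ltW.
Qed.

(** The reciprocal polynomial has no real root either: its value at 0 is the
    leading coefficient of [p]. Hence both are bounded away from 0 on
    [-1, 1]. *)
Lemma weight_le_horner (R : realType) (n : nat) (p : {poly R}) :
  size p = n.+1 -> (forall x, ~~ root p x) ->
  exists2 a, 0 < a & forall x, a * weight x ^+ n <= `|p.[x]|.
Proof.
move=> sp norootp; have [a a0 awayp] := horner_away_on_unit norootp.
have norootq x : ~~ root (reciprocal n p) x.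
  rewrite /root; have [->|x0] := eqVneq x 0.
    rewrite horner_reciprocal0 -[n]/(n.+1.-1) -sp.
    by rewrite lead_coef_eq0 -size_poly_eq0 sp.
  apply: contra (norootp x^-1) => /eqP qx0.
  by rewrite /root (@horner_reciprocal _ n) ?sp ?invr_eq0 // invrK qx0 mulr0.
have [b b0 awayq] := horner_away_on_unit norootq.
exists (Num.min a b) => [|x]; first by rewrite lt_min a0.
rewrite /weight; have [x1|x1] := leP `|x| 1.
  by rewrite expr1n mulr1 ge_min awayp.
have x0 : x != 0 by rewrite -normr_gt0 (lt_trans ltr01).
rewrite (@horner_reciprocal _ n) ?sp // normrM normrX [leRHS]mulrC.
rewrite ler_wpM2r ?exprn_ge0 // ge_min awayq ?orbT //.
by rewrite normfV invf_le1 ?normr_gt0 // ltW.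
Qed.

Lemma size_sqrD1 (R : realType) (d : nat) (f : {poly R}) :
  (0 < d)%N -> size f = d.+1 -> size (f ^+ 2 + 1) = (d * 2).+1.
Proof.
move=> d0 sf; have f0 : f != 0 by rewrite -size_poly_eq0 sf.
have sf2 : size (f ^+ 2) = (d * 2).+1.
  have := size_exp f 2; rewrite sf /= => <-.
  by rewrite prednK // lt0n size_poly_eq0 expf_neq0.
by rewrite size_polyDl sf2 // size_poly1 ltnS muln_gt0 d0.
Qed.

Lemma sqrD1_noroot (R : realType) (f : {poly R}) (x : R) :
  ~~ root (f ^+ 2 + 1) x.
Proof. by rewrite /root !hornerE gt_eqF // ltr_wpDl // sqr_ge0. Qed.

(** Both sides of the equality grow like the [d]-th power of the weight. *)
Lemma weight_le_of_eq_horner (R : realType) (d : nat) (f g : {poly R}) :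
  (0 < d)%N -> size f = d.+1 -> size g = d.+1 ->
  exists2 K, 0 < K & forall x u, f.[x] = g.[u] -> weight x <= K * weight u.
Proof.
move=> d0 sf sg.
have [a a0 lowf] := weight_le_horner (size_sqrD1 d0 sf) (sqrD1_noroot f).
have [|C C0 upg] := @horner_le_weight _ (d * 2) (g ^+ 2 + 1).
  by rewrite (size_sqrD1 d0 sg).
pose K := Num.max 1 (C / a); have K1 : 1 <= K by rewrite le_max lexx.
have K0 : 0 < K := lt_le_trans ltr01 K1.
exists K => // x u fg; have d20 : (0 < d * 2)%N by rewrite muln_gt0 d0.
rewrite -(ler_pXn2r d20) ?nnegrE ?mulr_ge0 ?weight_ge0 ?(ltW K0) // exprMn.
have le_ratio : weight x ^+ (d * 2) <= C / a * weight u ^+ (d * 2).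
  rewrite mulrAC ler_pdivlMr // mulrC (le_trans (lowf x)) //.
  by apply: le_trans (upg u); rewrite !hornerE fg.
apply: (le_trans le_ratio); rewrite ler_wpM2r ?exprn_ge0 ?weight_ge0 //.
(* [C / a <= K <= K ^+ (d * 2)], the last because [1 <= K] *)
by rewrite (@le_trans _ _ K) ?le_max ?lexx ?orbT // ler_eXnr.
Qed.

(** * Polynomials without critical points are bijections *)

Lemma noroot_sign (R : realType) (p : {poly R}) :
  (forall x, ~~ root p x) -> (forall x, 0 < p.[x]) \/ (forall x, p.[x] < 0).
Proof.
move=> noroot.
have same_sign x y : p.[x] <= 0 -> 0 <= p.[y] -> False.
  move=> px py; have [xy|/ltW yx] := leP x y.
    by have [|z _] := poly_ivt xy (p := p); rewrite ?px // (negbTE (noroot z)).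
  have [|z _] := poly_ivt yx (p := - p).
    by rewrite !hornerN oppr_le0 oppr_ge0 py.
  by rewrite rootN (negbTE (noroot z)).
have [p0|p0] := ltP 0 p.[0]; [left|right] => x; rewrite ltNge; apply/negP.
  by move=> px; exact: (same_sign x 0 px (ltW p0)).
exact: same_sign p0.
Qed.

Lemma horner_expanding (R : realType) (g : {poly R}) (a x y : R) :
  (forall z, a <= g^`().[z]) -> x <= y -> a * (y - x) <= g.[y] - g.[x].
Proof.
move=> g'a xy.
have [|c _ ->] := @MVT_segment R (horner g) (horner g^`()) x y xy
  (fun z _ => is_derive_poly g z).
  exact/continuous_subspaceT/continuous_horner.
by rewrite ler_wpM2r ?subr_ge0.
Qed.

Lemma bijective_horner_expanding (R : realType) (g : {poly R}) (a : R) :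
  0 < a -> (forall z, a <= g^`().[z]) -> bijective (horner g).
Proof.
move=> a0 g'a.
have surj y : exists x, g.[x] == y.
  (* Over a length [M], [g] grows by at least the distance from [g.[0]] to
     [y], so [y] lies between [g.[- M]] and [g.[M]]. *)
  pose M := `|y - g.[0]| / a.
  have M0 : 0 <= M by rewrite divr_ge0 // ltW.
  have aM : a * M = `|y - g.[0]| by rewrite mulrC divfK // gt_eqF.
  have NM0 : - M <= 0 by rewrite oppr_le0.
  have right_end := horner_expanding g'a M0.
  have left_end := horner_expanding g'a NM0.
  rewrite subr0 aM in right_end; rewrite sub0r opprK aM in left_end.
  have [||x _ gx] := @poly_ivt R (g - y%:P) (- M) M.
  - exact: le_trans NM0 M0.
  - rewrite !hornerE subr_le0 subr_ge0; apply/andP; split.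
      have := le_trans (ler_norm (- (y - g.[0]))); rewrite normrN.
      by move=> /(_ _ left_end); rewrite opprB lerD2l lerN2.
    by have := le_trans (ler_norm _) right_end; rewrite lerD2r.
  by exists x; rewrite -subr_eq0; move: gx; rewrite /root !hornerE.
have inj : injective (horner g).
  have mono x y : x <= y -> g.[x] = g.[y] -> x = y.
    move=> xy gxy; have := horner_expanding g'a xy.
    rewrite gxy subrr pmulr_rle0 // subr_le0 => yx.
    by apply/eqP; rewrite eq_le xy.
  by move=> x y gxy; have [/mono->|/ltW/mono->] := leP x y.
have gK y : g.[xchoose (surj y)] = y by apply/eqP/(xchooseP (surj y)).
by exists (fun y => xchoose (surj y)) => // x; apply: inj; rewrite gK.
Qed.

(** The derivative has a constant sign, so up to replacing [g] by [- g] it is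
    bounded below by a positive constant. In particular the degree of [g] is
    odd, as a consequence of surjectivity. *)
Lemma bijective_horner (R : realType) (n : nat) (g : {poly R}) :
  size g^`() = n.+1 -> (forall x, ~~ root g^`() x) -> bijective (horner g).
Proof.
move=> sg' noroot; have [a a0 low] := weight_le_horner sg' noroot.
have {}low x : a <= `|g^`().[x]|.
  apply: le_trans (low x).
  by rewrite ler_peMr ?(ltW a0) // exprn_ege1 // weight_ge1.
have [g'0|g'0] := noroot_sign noroot.
  apply: (bijective_horner_expanding a0) => z.
  by rewrite -[leRHS]gtr0_norm.
have [|h hK gK] := @bijective_horner_expanding R (- g) a a0.
  by move=> z; rewrite derivN hornerN -ltr0_norm.
exists (fun y => h (- y)) => x; first by rewrite -hornerN hK.
by rewrite -[LHS]opprK -hornerN gK opprK.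
Qed.

(** * The Lipschitz bound *)

Lemma is_derive1_continuous (R : realType) (phi dphi : R -> R) :
  (forall x : R, is_derive x 1 phi (dphi x)) -> continuous phi.
Proof.
move=> phi' z; apply: differentiable_continuous.
by apply/derivable1_diffP; case: (phi' z).
Qed.

Lemma lipschitz_bounded_derive (R : realType) (phi dphi : R -> R) (L : R) :
  (forall x : R, is_derive x 1 phi (dphi x)) -> (forall x, `|dphi x| <= L) ->
  lipschitz phi.
Proof.
move=> phi' bound; apply: (@klipschitzW _ _ _ L).
  exact: (@globally_properfilter _ _ (0, 0)).
move=> [x y] _ /=.
wlog xy : x y / y <= x.
  by move=> H; have [/H//|/ltW/H] := leP y x; rewrite distrC (distrC y).
have [|c _ ->] := @MVT_segment R phi dphi y x xy (fun z _ => phi' z).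
  exact/continuous_subspaceT/(is_derive1_continuous phi').
by rewrite normrM ler_wpM2r.
Qed.

(** The factors [weight x ^+ n] from the numerator and [weight u ^+ n] from the
    denominator of the derivative cancel up to a constant, as [u = h f.[x]] satisfies
    [f.[x] = g.[u]]. *)
Lemma value_matching_regular (R : realType) (n : nat) (f g : {poly R})
    (h : R -> R) :
  size f = n.+2 -> size g = n.+2 -> (forall x, ~~ root g^`() x) ->
  cancel (horner g) h -> cancel h (horner g) ->
  continuous (h \o horner f) /\ lipschitz (h \o horner f).
Proof.
move=> sf sg noroot gK hK; pose phi := h \o horner f.
pose dphi x := f^`().[x] / g^`().[phi x].
have phi' (x : R) : is_derive x 1 phi (dphi x).
  have h' : is_derive (f.[x] : R) 1 h (g^`().[phi x])^-1.
    rewrite -[f.[x]]hK; apply: (@is_derive_inverse R (horner g)).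
    - by near=> y; exact: gK.
    - by near=> y; exact: continuous_horner.
    - exact: noroot.
  rewrite /dphi mulrC; exact: is_derive1_comp.
have [|C C0 up] := @horner_le_weight R n f^`().
  by rewrite polyorder.size_deriv sf.
have [|a a0 low] := @weight_le_horner R n g^`() _ noroot.
  by rewrite polyorder.size_deriv sg.
have [K K0 wK] := weight_le_of_eq_horner (ltn0Sn n) sf sg.
split; first exact: is_derive1_continuous phi'.
apply: (@lipschitz_bounded_derive _ _ _ (C * K ^+ n / a) phi') => x.
rewrite normrM normfV ler_pdivrMr ?normr_gt0 ?noroot //.
apply: (le_trans (up x)); rewrite -mulrA -mulrA ler_pM2l //.
have wx : weight x ^+ n <= K ^+ n * weight (phi x) ^+ n.
  rewrite -exprMn lerXn2r ?nnegrE ?mulr_ge0 ?weight_ge0 ?(ltW K0) //.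
  by apply: wK; rewrite /phi /= hK.
apply: (le_trans wx); rewrite -mulrA ler_pM2l ?exprn_gt0 //.
by rewrite [leRHS]mulrC ler_pdivlMr // mulrC.
Unshelve. all: by end_near. Qed.

Lemma nocrit_noroot_deriv (R : realType) (f : {poly R}) :
  ~ (exists x : R, critical_point (horner f) x) -> forall x, ~~ root f^`() x.
Proof.
move=> nocrit x; apply/negP => /eqP f'x; apply: nocrit; exists x; split.
  exact: derivable_horner.
by rewrite -derivE.
Qed.

Theorem proposition1 (R : realType) (d : nat) (f g : {poly R})
    (d_ge1 : (1 <= d)%N)
    (* [size p] is one more than the degree of [p] *)
    (deg_f : size f = d.+1) (deg_g : size g = d.+1)
    (f_nocrit : ~ exists x : R, critical_point (horner f) x)
    (g_nocrit : ~ exists x : R, critical_point (horner g) x) :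
  lipschitz_equivalent (horner f) (horner g).
Proof.
case: d d_ge1 deg_f deg_g => // n _ sf sg.
have f'0 := nocrit_noroot_deriv f_nocrit.
have g'0 := nocrit_noroot_deriv g_nocrit.
have [|h fK hK] := @bijective_horner _ n f _ f'0.
  by rewrite polyorder.size_deriv sf.
have [|k gK kK] := @bijective_horner _ n g _ g'0.
  by rewrite polyorder.size_deriv sg.
have [phi_cont phi_lip] := value_matching_regular sf sg g'0 gK kK.
have [psi_cont psi_lip] := value_matching_regular sg sf f'0 fK hK.
exists (k \o horner f), 1; split => [||x]; last by rewrite mul1r /= kK.
- exists (h \o horner g); split; last by split.
  by split => // x /=; rewrite ?kK ?hK.
- exact: ltr01.
Qed.
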